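(* Let $n\ge1$ and fix free generators $g_1,\dots,g_n$ of $\mathcal F_n$. Let $H$ be dense in $\widehat{\mathcal F_n}$ and containing $g_1,\dots,g_n$. Then the set $\{g_1,\dots,g_n\}$ is $\emptyset$-definable in $H$ (i.e. definable by a first-order formula without parameters in the language $\mathcal L_{HA}=\{0,1,\sqcap,\sqcup,\to\}$ of Heyting algebras).
   Context: Fix $n\ge1$ and symbols $P_1,\dots,P_n$. The partially ordered set $(K_n,\le)$ with valuation map $\mathrm{val}:K_n\to\mathfrak P(\{P_1,\dots,P_n\})$ is the increasing union of finite sets $K_n^d$ ($d\ge 0$) built recursively: $K_n^{-1}=\emptyset$, and $K_n^d\setminus K_n^{d-1}$ consists of exactly one point $w_{\beta,Y}$ for each pair $(\beta,Y)$ such that (i) $Y$ is a decreasing subset of $K_n^{d-1}$ with $Y\not\subseteq K_n^{d-2}$ (for $d=0$ this last condition is void, so $Y=\emptyset$); (ii) $\beta\subseteq\{P_1,\dots,P_n\}$ and $\beta\subseteq\mathrm{val}(w')$ for all $w'\in Y$; (iii) if $Y$ is the decreasing set generated by a single element $w_{\beta',Y'}$, then $\beta\ne\beta'$. One sets $\mathrm{val}(w_{\beta,Y})=\beta$, and $w\le w_{\beta,Y}$ iff $w\in Y$ or $w=w_{\beta,Y}$. $\widehat{\mathcal F_n}:=\mathcal O_\downarrow(K_n,\le)$ is the Heyting algebra of all decreasing subsets of $K_n$ ($\sqcap=\cap$, $\sqcup=\cup$, $a\to b$ = the largest decreasing set contained in $(K_n\setminus a)\cup b$). By a theorem of Bellissima,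 the Heyting sub-algebra of $\widehat{\mathcal F_n}$ generated by $g_i=\{w\in K_n: P_i\in\mathrm{val}(w)\}$, $i=1,\dots,n$, is free on $g_1,\dots,g_n$; the free Heyting algebra $\mathcal F_n$, with its fixed free generators, is identified with it. $\widehat{\mathcal F_n}$ carries the metric $\mathrm d(a,b)=2^{-\min\{i\in\mathbb N\mid a\cap K_n^i\neq b\cap K_n^i\}}$ ($2^{-\min\emptyset}=0$). ''$H$ is dense in $\widehat{\mathcal F_n}$'' means that $H$ is a Heyting sub-algebra of $\widehat{\mathcal F_n}$ that is dense for this metric. *)

(* Defs.v *)
From HB Require Import structures.
From mathcomp Require Import all_boot all_order all_algebra.
From mathcomp Require Import boolp classical_sets reals.

Set Implicit Arguments.
Unset Strict Implicit.
Unset Printing Implicit Defensive.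

Import Order.TTheory GRing.Theory Num.Theory.

Local Open Scope classical_set_scope.

(* Raw trees: [W beta Y] stands for w_{beta,Y}, a subset of {P_1, ..., P_n}
   being a [{set 'I_n}]. The finite set Y is a sequence of points here; only
   the trees occurring in some [stage] below are points of K_n. *)
Inductive tree (n : nat) : Type := W of {set 'I_n} & seq (tree n).

Section TreeCountable.
Variable n : nat.

Fixpoint tree_enc (t : tree n) : GenTree.tree {set 'I_n} :=
  let: W beta Y := t in
  GenTree.Node 0 (GenTree.Leaf beta :: map tree_enc Y).

Fixpoint tree_dec (t : GenTree.tree {set 'I_n}) : option (tree n) :=
  if t is GenTree.Node _ (GenTree.Leaf beta :: ts)
  then Some (W beta (pmap tree_dec ts)) else None.

Lemma tree_encK : pcancel tree_enc tree_dec.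
Proof.
rewrite /pcancel; fix IH 1 => -[beta Y] /=; congr (Some (W _ _)).
by elim: Y => //= t Y IHY; rewrite IH /= IHY.
Qed.

HB.instance Definition _ := Countable.copy (tree n) (pcan_type tree_encK).
End TreeCountable.

Definition tree_val n (t : tree n) : {set 'I_n} := let: W beta _ := t in beta.
Definition tree_below n (t : tree n) : seq (tree n) := let: W _ Y := t in Y.
Definition tree_le n (v w : tree n) : bool := (v \in tree_below w) || (v == w).

Definition decreasing_in n (L Y : seq (tree n)) : bool :=
  all (fun w => all (fun v => tree_le v w ==> (v \in Y)) L) Y.

Definition principal n (L : seq (tree n)) (w : tree n) : seq (tree n) :=
  [seq v <- L | tree_le v w].

Definition subseqs (T : Type) (L : seq T) : seq (seq T) :=
  [seq mask (val m) L | m <- enum {: (size L).-tuple bool}].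

(* [L] enumerates K_n^{d-1} without repetition, so that each subset Y of
   K_n^{d-1} is exactly one subsequence of [L]; [fresh Y] is the condition that
   Y is not included in K_n^{d-2}. *)
Definition new_point n (L : seq (tree n)) (fresh : pred (seq (tree n)))
    (beta : {set 'I_n}) (Y : seq (tree n)) : bool :=
  [&& decreasing_in L Y,
      fresh Y,
      all (fun w => beta \subset tree_val w) Y
    & all (fun w => (Y == principal L w) ==> (beta != tree_val w)) L].

Definition new_points n (L : seq (tree n)) (fresh : pred (seq (tree n))) :
    seq (tree n) :=
  [seq W p.1 p.2 | p <- [seq (beta, Y) | beta <- enum {set 'I_n},
                                         Y <- subseqs L]
                 & new_point L fresh p.1 p.2].

(* The pair (K_n^d, K_n^{d-1}), as duplicate-free enumerations. *)
Fixpoint stages (n d : nat) : seq (tree n) * seq (tree n) :=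
  if d is d'.+1 then
    let: (L, L') := stages n d' in
    (L ++ new_points L (fun Y => ~~ all (mem L') Y), L)
  else (new_points [::] predT, [::]).

Definition stage (n d : nat) : seq (tree n) := (stages n d).1.

Definition Kn (n : nat) : Type := {w : tree n | `[< exists d, w \in stage n d >]}.

Definition Kval n (w : Kn n) : {set 'I_n} := tree_val (val w).
Definition Kle n (v w : Kn n) : bool := tree_le (val v) (val w).
Definition Kstage n (d : nat) : set (Kn n) := [set w | val w \in stage n d].

Definition decreasing n (a : set (Kn n)) : Prop :=
  forall v w, a w -> Kle v w -> a v.

Record Fhat (n : nat) := MkFhat {
  points :> set (Kn n);
  points_decreasing : decreasing points }.

Section FhatOperations.
Variable n : nat.
Implicit Types a b : Fhat n.

Lemma decreasing0 : decreasing (set0 : set (Kn n)). Proof. by []. Qed.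
Lemma decreasingT : decreasing (setT : set (Kn n)). Proof. by []. Qed.

Lemma decreasingI a b : decreasing (points a `&` points b).
Proof.
by move=> v w [aw bw] vw; split; apply: points_decreasing vw.
Qed.

Lemma decreasingU a b : decreasing (points a `|` points b).
Proof.
by move=> v w [aw|bw] vw; [left|right]; apply: points_decreasing vw.
Qed.

(* The largest decreasing subset of [s], as the union of all of them. *)
Definition dec_interior (s : set (Kn n)) : set (Kn n) :=
  [set w | exists c : set (Kn n), [/\ decreasing c, c `<=` s & c w]].

Lemma dec_interior_decreasing s : decreasing (dec_interior s).
Proof. by move=> v w [c [cd cs cw]] vw; exists c; split=> //; apply: cd vw. Qed.

Lemma dec_interior_sub s : dec_interior s `<=` s.
Proof. by move=> w [c [_ + cw]]; apply. Qed.

Lemma dec_interior_largest s c :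
  decreasing c -> c `<=` s -> c `<=` dec_interior s.
Proof. by move=> cd cs w cw; exists c. Qed.

Definition Fhat0 : Fhat n := MkFhat decreasing0.
Definition Fhat1 : Fhat n := MkFhat decreasingT.
Definition Fhat_meet a b : Fhat n := MkFhat (@decreasingI a b).
Definition Fhat_join a b : Fhat n := MkFhat (@decreasingU a b).
Definition Fhat_imp a b : Fhat n :=
  MkFhat (@dec_interior_decreasing (~` points a `|` points b)).

End FhatOperations.

Record HAstructure := MkHAstructure {
  HAsort :> Type;
  HA0 : HAsort;
  HA1 : HAsort;
  HAmeet : HAsort -> HAsort -> HAsort;
  HAjoin : HAsort -> HAsort -> HAsort;
  HAimp : HAsort -> HAsort -> HAsort }.

(* First-order logic with equality over {0, 1, meet, join, ->}.
   [term k] and [formula k]: free variables among x_0, ..., x_{k-1}; a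
   quantifier over [formula k.+1] binds x_0 and shifts the other variables. *)
Inductive term (k : nat) : Type :=
| Var of 'I_k
| Zero
| One
| Meet of term k & term k
| Join of term k & term k
| Imp of term k & term k.

Inductive formula : nat -> Type :=
| Equal k of term k & term k : formula k
| Not k of formula k : formula k
| And k of formula k & formula k : formula k
| Or k of formula k & formula k : formula k
| Implies k of formula k & formula k : formula k
| Forall k of formula k.+1 : formula k
| Exists k of formula k.+1 : formula k.

Fixpoint eval (M : HAstructure) k (e : 'I_k -> M) (t : term k) : M :=
  match t with
  | Var i => e i
  | Zero => HA0 M
  | One => HA1 M
  | Meet t1 t2 => HAmeet (eval e t1) (eval e t2)
  | Join t1 t2 => HAjoin (eval e t1) (eval e t2)
  | Imp t1 t2 => HAimp (eval e t1) (eval e t2)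
  end.

Definition extend (A : Type) k (x : A) (e : 'I_k -> A) : 'I_k.+1 -> A :=
  fun i => if unlift ord0 i is Some j then e j else x.

Fixpoint holds (M : HAstructure) k (f : formula k) : ('I_k -> M) -> Prop :=
  match f in formula k return ('I_k -> M) -> Prop with
  | Equal _ t1 t2 => fun e => eval e t1 = eval e t2
  | Not _ g => fun e => ~ holds g e
  | And _ g h => fun e => holds g e /\ holds h e
  | Or _ g h => fun e => holds g e \/ holds h e
  | Implies _ g h => fun e => holds g e -> holds h e
  | Forall _ g => fun e => forall x : M, holds g (extend x e)
  | Exists _ g => fun e => exists x : M, holds g (extend x e)
  end.

Definition definable_without_parameters (M : HAstructure) (S : set M) : Prop :=
  exists f : formula 1, forall x : M, holds f (fun=> x) <-> S x.

Record subalgebra (M : HAstructure) (H : set M) : Prop := MkSubalgebra {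
  sub0 : H (HA0 M);
  sub1 : H (HA1 M);
  sub_meet : forall x y, H x -> H y -> H (HAmeet x y);
  sub_join : forall x y, H x -> H y -> H (HAjoin x y);
  sub_imp : forall x y, H x -> H y -> H (HAimp x y) }.

Definition substructure (M : HAstructure) (H : set M) (sH : subalgebra H) :
    HAstructure :=
  @MkHAstructure {x : M | H x}
    (exist _ _ (sub0 sH))
    (exist _ _ (sub1 sH))
    (fun x y => exist _ _ (sub_meet sH (proj2_sig x) (proj2_sig y)))
    (fun x y => exist _ _ (sub_join sH (proj2_sig x) (proj2_sig y)))
    (fun x y => exist _ _ (sub_imp sH (proj2_sig x) (proj2_sig y))).

Definition FhatHA (n : nat) : HAstructure :=
  @MkHAstructure (Fhat n) (Fhat0 n) (Fhat1 n)
    (@Fhat_meet n) (@Fhat_join n) (@Fhat_imp n).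

Lemma tree_val_le n d (v w : tree n) :
  w \in stage n d -> tree_le v w -> tree_val w \subset tree_val v.
Proof.
have new L fr : w \in new_points L fr -> tree_le v w -> tree_val w \subset tree_val v.
  case/mapP => -[beta Y]; rewrite mem_filter => /andP[/and4P[_ _ /allP Yb _] _].
  by move=> ->; rewrite /tree_le => /orP[/Yb|/eqP->].
elim: d => [|d IHd]; rewrite /stage /=; first exact: new.
case E: (stages n d) => [L L'] /=; rewrite mem_cat => /orP[wL|]; last exact: new.
by apply: IHd; rewrite /stage E.
Qed.

Lemma generator_decreasing n (i : 'I_n) : decreasing [set w | i \in Kval w].
Proof.
move=> v [w wK] /= iw vw; case/asboolP: (wK) => d wd.
exact: (fintype.subsetP (tree_val_le wd vw)).
Qed.

Definition generator n (i : 'I_n) : Fhat n :=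
  MkFhat (@generator_decreasing n i).

Definition differ_at n (a b : Fhat n) : pred nat :=
  fun i => `[< points a `&` Kstage i <> points b `&` Kstage i >].

(* 2^{- min {i | a and b differ on K_n^i}}, and 0 if this set is empty *)
Definition Fhat_dist (R : realType) n (a b : Fhat n) : R :=
  match pselect (exists i, differ_at a b i) with
  | left ex => (2 ^- ex_minn ex)%R
  | right _ => 0%R
  end.

Definition Fhat_dense (R : realType) n (H : set (Fhat n)) : Prop :=
  forall (a : Fhat n) (eps : R), (0 < eps)%R ->
    exists2 h, H h & (Fhat_dist R a h < eps)%R.

(* Main.v *)
(* By density H contains every finite decreasing set: an element of H agreeing
   with a subset of K_n^d up to K_n^{d+1} is equal to it. Hence the elements of H
   with a largest strictly smaller element are exactly the principal sets of the
   points of K_n, and the first-order theory of H sees the points of K_n, their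
   order, and their membership in the elements of H.
   The number of points with a given finite set Y of strict predecessors counts
   the subsets of the intersection of the valuations on Y (minus one of them if Y
   is principal), so it recovers cardinals of such intersections: the minimal
   points m with valuation {P_i} for some i are those with exactly one point just
   above m, and P_i belongs to val(w) depending on the number of points just
   above the decreasing set generated by w and m. This defines g_i from m. *)
Require Import Defs.
From mathcomp Require Import all_boot all_order all_algebra.
From mathcomp Require Import boolp classical_sets reals.

Import Order.TTheory GRing.Theory Num.Theory.

Set Implicit Arguments.
Unset Strict Implicit.
Unset Printing Implicit Defensive.

Local Open Scope classical_set_scope.

(** * Subsets encoded as subsequences of a duplicate-free sequence *)

Lemma mem_subseqs (T : eqType) (L Y : seq T) : (Y \in subseqs L) = subseq Y L.
Proof.
apply/mapP/subseqP => [[m _ ->]|[m /eqP sz ->]].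
  by exists (val m) => //; rewrite size_tuple.
by exists (Tuple sz) => //; rewrite mem_enum.
Qed.

Lemma mask_inj_uniq (T : eqType) (L : seq T) (m1 m2 : bitseq) :
  uniq L -> size m1 = size L -> size m2 = size L ->
  mask m1 L = mask m2 L -> m1 = m2.
Proof.
case: L => [|x0 L] uL s1 s2 E; first by rewrite (size0nil s1) (size0nil s2).
apply: (@eq_from_nth _ false) => [|i]; rewrite s1 ?s2 // => ilt.
have := congr1 (fun s : seq T => nth x0 (x0 :: L) i \in s) E.
by rewrite !in_mask // mem_nth // !index_uniq.
Qed.

Lemma subseqs_uniq (T : eqType) (L : seq T) : uniq L -> uniq (subseqs L).
Proof.
move=> uL; rewrite map_inj_in_uniq ?enum_uniq // => m1 m2 _ _ E.
by apply/val_inj/(mask_inj_uniq uL _ _ E); rewrite size_tuple.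
Qed.

(** Each side is [L] filtered by its own membership. *)
Lemma subseq_eq_mem (T : eqType) (L Y1 Y2 : seq T) :
  uniq L -> subseq Y1 L -> subseq Y2 L -> Y1 =i Y2 -> Y1 = Y2.
Proof.
move=> uL /(subseq_uniqP uL) e1 /(subseq_uniqP uL) e2 E; rewrite e1 e2.
by apply: eq_filter => t; rewrite E.
Qed.

(** * The levels of K_n *)

Lemma mem_new_points n (L : seq (tree n)) fr t :
  (t \in new_points L fr) =
  subseq (tree_below t) L && new_point L fr (tree_val t) (tree_below t).
Proof.
apply/mapP/andP => [[[b Y]]|].
  rewrite mem_filter => /andP[np /allpairsP[[b' Y'] [_ + [eb eY]]]] ->.
  by rewrite mem_subseqs /= -eY.
case: t => b Y /= [sY np]; exists (b, Y) => //; rewrite mem_filter np /=.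
by apply/allpairsP; exists (b, Y); rewrite mem_subseqs mem_enum.
Qed.

Lemma new_points_uniq n (L : seq (tree n)) fr :
  uniq L -> uniq (new_points L fr).
Proof.
move=> uL; rewrite map_inj_in_uniq => [|[b Y] [b' Y'] _ _ [-> ->]] //.
rewrite filter_uniq // allpairs_uniq ?enum_uniq ?subseqs_uniq //.
by move=> [? ?] [].
Qed.

(* K_n^{d-1}, so that [K_n^d] is the disjoint union of [prev_stage n d] and
   [level n d]. *)
Definition prev_stage (n d : nat) : seq (tree n) := (stages n d).2.

(** At level [k.+1] the stage to leave is K_n^(k-1), which is [prev_stage n k]; at level 0 the
    condition is void. *)
Definition fresh (n d : nat) : pred (seq (tree n)) :=
  if d is k.+1 then fun Y => ~~ all (mem (prev_stage n k)) Y else predT.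
Arguments fresh : clear implicits.

Definition level (n d : nat) : seq (tree n) :=
  new_points (prev_stage n d) (fresh n d).

Lemma prev_stageS n d : prev_stage n d.+1 = stage n d.
Proof. by rewrite /prev_stage /stage /=; case: (stages n d). Qed.

Lemma stageE n d : stage n d = prev_stage n d ++ level n d.
Proof.
case: d => // d; rewrite /level /fresh /prev_stage /stage /=.
by case E: (stages n d).
Qed.

Lemma prev_stage_sub n k d :
  (k <= d)%N -> {subset prev_stage n k <= prev_stage n d}.
Proof.
move=> /subnK<-; elim: (d - k)%N => // j IH t /IH.
by rewrite addSn prev_stageS stageE mem_cat => ->.
Qed.

Lemma prev_stage_level n d t :
  t \in prev_stage n d -> exists2 e, (e < d)%N & t \in level n e.
Proof.
elim: d => // d IH; rewrite prev_stageS stageE mem_cat => /orP[/IH[e ed te]|].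
  by exists e => //; apply: ltnW.
by exists d.
Qed.

Lemma level_below n d t :
  t \in level n d -> {subset tree_below t <= prev_stage n d}.
Proof. by rewrite mem_new_points => /andP[/mem_subseq]. Qed.

Lemma level_fresh n d t : t \in level n d -> fresh n d (tree_below t).
Proof. by rewrite mem_new_points => /andP[_ /and4P[]]. Qed.

(** If [e] were [k.+1] with [d <= k], freshness of [s] would fail, as everything below [t] lies in
    K_n^(k-1). Hence the set below a point determines its level. *)
Lemma level_le n d e t s : t \in level n d -> s \in level n e ->
  {subset tree_below s <= tree_below t} -> (e <= d)%N.
Proof.
case: e => // e td se sub; rewrite leqNgt; apply/negP; rewrite ltnS => de.
move/level_fresh: se => /negP; apply; apply/allP => u us.
by apply: (prev_stage_sub de); apply: level_below td _ _; apply: sub.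
Qed.

Lemma level_notin_prev n d t : t \in level n d -> t \notin prev_stage n d.
Proof.
move=> td; apply/negP => /prev_stage_level[e ed te].
by have := level_le te td (fun=> id); rewrite leqNgt ed.
Qed.

Lemma prev_stage_uniq n d : uniq (prev_stage n d).
Proof.
elim: d => // d IH; rewrite prev_stageS stageE cat_uniq IH new_points_uniq //.
by rewrite andbT; apply/hasPn => t /level_notin_prev.
Qed.

Lemma prev_stage_closed n d t s :
  t \in prev_stage n d -> s \in tree_below t -> s \in prev_stage n d.
Proof.
move=> /prev_stage_level[e ed te] /(level_below te).
by apply: prev_stage_sub; apply: ltnW.
Qed.

Lemma level_below_trans n d t s r : t \in level n d ->
  s \in tree_below t -> r \in tree_below s -> r \in tree_below t.
Proof.
move=> td st rs; move: (td); rewrite mem_new_points => /andP[_ /and4P[dt _ _ _]].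
have sp := level_below td st; move/allP: dt => /(_ _ st)/allP/(_ r).
by move=> /(_ (prev_stage_closed sp rs)); rewrite /tree_le rs.
Qed.

Lemma level_below_irr n d t : t \in level n d -> t \notin tree_below t.
Proof.
by move=> td; apply: contra (level_notin_prev td) => /(level_below td).
Qed.

Lemma Kn_level n (w : Kn n) : exists d, val w \in level n d.
Proof.
case: w => t /= /asboolP[d]; rewrite -prev_stageS => /prev_stage_level[e _ te].
by exists e.
Qed.

Lemma prev_stage_Kn n d t : t \in prev_stage n d -> exists w : Kn n, val w = t.
Proof.
move=> td; suff tK : `[< exists e, t \in stage n e >] by exists (exist _ t tK).
apply/asboolP; exists d; by rewrite stageE mem_cat td.
Qed.

(** * Strict and principal decreasing sets of K_n *)

Definition strict n (w : Kn n) : set (Kn n) :=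
  [set v | val v \in tree_below (val w)].

Definition down n (w : Kn n) : set (Kn n) := [set v | Kle v w].

Lemma strict_irr n (w : Kn n) : ~ strict w w.
Proof. by have [d wd] := Kn_level w; apply/negP/(level_below_irr wd). Qed.

Lemma down_refl n (w : Kn n) : down w w.
Proof. by rewrite /down /= /Kle /tree_le eqxx orbT. Qed.

Lemma strict_down n (w : Kn n) : strict w `<=` down w.
Proof. by move=> v; rewrite /down /= /Kle /tree_le /strict /= => ->. Qed.

Lemma down_strict n (v w : Kn n) : down w v -> strict w v \/ v = w.
Proof.
by rewrite /down /= /Kle /tree_le => /orP[|/eqP/val_inj]; [left|right].
Qed.

Lemma strict_decreasing n (w : Kn n) : decreasing (strict w).
Proof.
have [d wd] := Kn_level w => u v vw /down_strict[uv|-> //].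
exact: (level_below_trans wd vw uv).
Qed.

Lemma down_decreasing n (w : Kn n) : decreasing (down w).
Proof.
move=> u v /down_strict[vw uv|-> //].
by apply: strict_down; apply: strict_decreasing uv.
Qed.

Lemma down_min n (w : Kn n) a : decreasing a -> a w -> down w `<=` a.
Proof. by move=> da aw v; apply: da. Qed.

Lemma down_inj n (v w : Kn n) : down v = down w -> v = w.
Proof.
move=> E; have : down w v by rewrite -E; apply: down_refl.
case/down_strict => // vw; case: (@strict_irr _ w).
have : down v w by rewrite E; apply: down_refl.
case/down_strict => [wv|{2}-> //].
exact: strict_decreasing vw (strict_down wv).
Qed.

Lemma down_Kstage n (w : Kn n) : exists d, down w `<=` Kstage (n := n) d.
Proof.
have [d wd] := Kn_level w; exists d => v /down_strict[vw|->];
  rewrite /Kstage /= stageE mem_cat ?wd ?orbT //.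
by rewrite (level_below wd vw).
Qed.

(** * Points of K_n as pairs of a valuation and a decreasing set *)

Lemma Kval_strict n (v w : Kn n) : strict w v -> Kval w \subset Kval v.
Proof.
case: (w) => t tK; rewrite /strict /Kval /= => vt.
by case/asboolP: (tK) => d /tree_val_le; apply; rewrite /tree_le vt.
Qed.

(** This carries the clause of [new_point] about [principal] from sequences over to sets of
    points. *)
Lemma Kval_strict_down n (v w : Kn n) : strict w = down v -> Kval w != Kval v.
Proof.
have [d wd] := Kn_level w => E.
have vw : val v \in tree_below (val w).
  by have : strict w v by rewrite E; apply: down_refl.
move: (wd); rewrite mem_new_points => /andP[sw /and4P[_ _ _ /allP]].
move=> /(_ _ (level_below wd vw)) /implyP; apply; apply/eqP.
apply: (subseq_eq_mem (prev_stage_uniq n d) sw); first exact: filter_subseq.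
move=> t; rewrite mem_filter.
case tp: (t \in prev_stage n d); last first.
  by rewrite andbF; apply/negP => /(level_below wd); rewrite tp.
have [u <-] := prev_stage_Kn tp; rewrite andbT.
apply/idP/idP => [uw|uv]; first by have : down v u by rewrite -E.
by have : strict w u by rewrite E.
Qed.

(** Equal sets below force equal levels by [level_le], and within one stage equal sets are equal
    sequences. *)
Lemma Kn_ext n (v w : Kn n) : strict v = strict w -> Kval v = Kval w -> v = w.
Proof.
move=> Es Ev; have [d vd] := Kn_level v; have [e we] := Kn_level w.
have mem_below (x y : Kn n) : strict x = strict y ->
    {subset tree_below (val x) <= tree_below (val y)}.
  move=> E t tx; have [k xk] := Kn_level x.
  have [u ut] := prev_stage_Kn (level_below xk tx).
  have : strict x u by rewrite /strict /= ut.
  by rewrite E /strict /= ut.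
have vw := mem_below _ _ Es; have wv := mem_below _ _ (esym Es).
have de : d = e.
  by apply/eqP; rewrite eqn_leq (level_le we vd vw) (level_le vd we wv).
move: vd we; rewrite !mem_new_points -de => /andP[sv _] /andP[sw _].
have Eb : tree_below (val v) = tree_below (val w).
  apply: (subseq_eq_mem (prev_stage_uniq n d) sv sw) => t.
  by apply/idP/idP; [apply: vw|apply: wv].
move: Ev Eb; rewrite /Kval => Ev Eb; apply: val_inj.
by case: (val v) (val w) Ev Eb => [b Y] [b' Y'] /= -> ->.
Qed.

(** The point is built at the least level [e] whose previous stage contains [Y]; the bound [d]
    ensures that such a level exists. *)
Lemma Kn_exists n (d : nat) (Y : set (Kn n)) (b : {set 'I_n}) :
  decreasing Y -> Y `<=` Kstage (n := n) d ->
  (forall v, Y v -> b \subset Kval v) ->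
  (forall v, Y = down v -> b != Kval v) ->
  exists w : Kn n, strict w = Y /\ Kval w = b.
Proof.
move=> dY Yd bY bne.
pose P e := `[< forall v, Y v -> val v \in prev_stage n e >].
have exP : exists e, P e.
  by exists d.+1; apply/asboolP => v /Yd; rewrite prev_stageS.
case: (ex_minnP exP) => e /asboolP Ye min_e.
pose Ys := [seq t <- prev_stage n e | `[< exists2 v, Y v & val v = t >]].
have memYs (v : Kn n) : val v \in Ys <-> Y v.
  rewrite mem_filter; split=> [/andP[/asboolP[u Yu /val_inj <-]] //|Yv].
  by rewrite Ye // andbT; apply/asboolP; exists v.
have YsP t : t \in Ys -> exists2 v : Kn n, Y v & val v = t.
  by rewrite mem_filter => /andP[/asboolP].
have tl : W b Ys \in level n e.
  rewrite mem_new_points filter_subseq andTb; apply/and4P; split.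
  - apply/allP => _ /YsP[v Yv <-].
    apply/allP => t tp; apply/implyP.
    have [u <-] := prev_stage_Kn tp => uv.
    by apply/memYs; apply: dY Yv uv.
  (* Were [Ys] contained in the stage before, [P e] would contradict the minimality of [e.+1]. *)
  - case: e min_e @Ys Ye memYs YsP => [|e] // min_e Ys Ye memYs YsP.
    apply/negP => /allP YsE; suff /min_e : P e by rewrite ltnn.
    by apply/asboolP => v /memYs/YsE.
  - by apply/allP => _ /YsP[v Yv <-]; apply: bY.
  - apply/allP => t tp; have [v vt] := prev_stage_Kn tp; rewrite -vt in tp *.
    apply/implyP; rewrite /= => /eqP E; apply: bne; apply/seteqP; split=> u.
      by move=> /memYs; rewrite E mem_filter => /andP[].
    move=> uv; apply/memYs; rewrite E mem_filter; apply/andP; split=> //.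
    case/down_strict: uv => [uv|-> //].
    exact: prev_stage_closed tp uv.
have tK : `[< exists k, W b Ys \in stage n k >].
  by apply/asboolP; exists e; rewrite stageE mem_cat tl orbT.
exists (exist _ (W b Ys) tK); split=> //.
by apply/seteqP; split=> u; rewrite /strict /= => /memYs.
Qed.

(** * Counting the points just above one or two principal sets *)

Lemma Kval_down n (v w : Kn n) : down w v -> Kval w \subset Kval v.
Proof. by case/down_strict => [/Kval_strict|->]. Qed.

Lemma cover_proper n (u w : Kn n) : strict u = down w -> Kval u \proper Kval w.
Proof.
move=> E; rewrite finset.properEneq Kval_strict_down //=.
by apply: Kval_strict; rewrite E; apply: down_refl.
Qed.

(** Only [w] generates [down w], so the one excluded valuation is [Kval w]. *)
Lemma cover_exists n (w : Kn n) (b : {set 'I_n}) :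
  b \proper Kval w -> exists u, strict u = down w /\ Kval u = b.
Proof.
rewrite finset.properEneq => /andP[bw sbw]; have [d wd] := down_Kstage w.
apply: (Kn_exists (@down_decreasing _ w) wd) => v; last by move=> /down_inj <-.
by move=> /Kval_down; apply: fintype.subset_trans.
Qed.

Lemma decreasing_setU n (a b : set (Kn n)) :
  decreasing a -> decreasing b -> decreasing (a `|` b).
Proof.
by move=> da db v w [aw|bw] vw; [left; apply: da vw|right; apply: db vw].
Qed.

Lemma Kstage_sub n d e : (d <= e)%N -> Kstage (n := n) d `<=` Kstage e.
Proof.
by move=> de w; rewrite /Kstage /= -!prev_stageS; apply: prev_stage_sub.
Qed.

Lemma Kstage_setU n (a b : set (Kn n)) :
  (exists d, a `<=` Kstage (n := n) d) -> (exists d, b `<=` Kstage (n := n) d) ->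
  exists d, a `|` b `<=` Kstage (n := n) d.
Proof.
move=> [d ad] [e be]; exists (maxn d e) => w [/ad|/be]; apply: Kstage_sub.
  exact: leq_maxl.
exact: leq_maxr.
Qed.

(** A union of two incomparable principal sets is not principal, so no valuation is excluded. *)
Lemma join_exists n (v w : Kn n) (b : {set 'I_n}) :
  ~ down w v -> ~ down v w -> b \subset Kval v -> b \subset Kval w ->
  exists u, strict u = down w `|` down v /\ Kval u = b.
Proof.
move=> wv vw bv bw.
have [d bd] := Kstage_setU (down_Kstage w) (down_Kstage v).
apply: Kn_exists bd _ _ => [|x [] /Kval_down|x E].
- by apply: decreasing_setU; apply: down_decreasing.
- exact: fintype.subset_trans.
- exact: fintype.subset_trans.
have : (down w `|` down v) x by rewrite E; apply: down_refl.
case=> [wx|vx]; [case: wv|case: vw].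
  apply: (down_min (@down_decreasing _ w) wx).
  by rewrite -E; right; apply: down_refl.
apply: (down_min (@down_decreasing _ v) vx).
by rewrite -E; left; apply: down_refl.
Qed.

(* [w_{beta,Y}] with [Y] generated by [m] exists for each proper subset [beta]
   of [val m], so it is unique exactly when [val m] is a singleton. *)
Lemma Kval_singleton n (m : Kn n) :
  (exists u, strict u = down m /\ forall u', strict u' = down m -> u' = u) <->
  exists i, Kval m = [set i]%SET.
Proof.
split=> [[u [um uniq_u]]|[i mi]].
  have [_ [i im _]] := properP (cover_proper um); exists i.
  apply/eqP; case: eqVneq => // mi.
  have [|u0 [u0m v0]] := @cover_exists _ m finset.set0.
    by rewrite finset.proper0; apply/finset.set0Pn; exists i.
  have [|u1 [u1m v1]] := @cover_exists _ m [set i]%SET.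
    by rewrite finset.properEneq eq_sym mi finset.sub1set.
  move: v0; rewrite (uniq_u _ u0m) -(uniq_u _ u1m) v1 => /finset.setP/(_ i).
  by rewrite !inE eqxx.
have [|u [um u0]] := @cover_exists _ m finset.set0.
  by rewrite finset.proper0 mi; apply/finset.set0Pn; exists i; rewrite inE.
exists u; split=> // u' u'm; apply: Kn_ext; rewrite ?um ?u'm // u0.
have := cover_proper u'm; rewrite mi finset.properEneq finset.subset1.
by case/andP=> /negPf -> /eqP.
Qed.

(* The points right above [down w `|` down m] carry the subsets of
   [val w :&: [set i]]; when [m] is below [w], the set is [down w], [val w] is
   a subset of [[set i]], and the subset [val w] itself is excluded. *)
Lemma Kval_count n (m w : Kn n) (i : 'I_n) :
  strict m = set0 -> Kval m = [set i]%SET ->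
  (i \in Kval w) <->
  (down w m /\ exists u, strict u = down w) \/
  (~ down w m /\ exists u u', [/\ u <> u', strict u = down w `|` down m
                                & strict u' = down w `|` down m]).
Proof.
move=> m0 mi.
split=> [iw|[[wm [u uw]]|[wm [u [u' [uu' ue ue']]]]]].
- case: (pselect (down w m)) => [wm|wm]; [left|right]; split=> //.
    have [|u [uw _]] := @cover_exists _ w finset.set0; last by exists u.
    by rewrite finset.proper0; apply/finset.set0Pn; exists i.
  have mw : ~ down m w.
    case/down_strict => [|wm']; first by rewrite m0.
    by apply: wm; rewrite wm'; apply: down_refl.
  have [||u [ue u0]] := join_exists wm mw (b := finset.set0);
    rewrite ?finset.sub0set //.
  have [||u' [ue' u'i]] := join_exists wm mw (b := [set i]%SET).
  + by rewrite mi.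
  + by rewrite finset.sub1set.
  exists u, u'; split=> // E; move: u0; rewrite E u'i => /finset.setP/(_ i).
  by rewrite !inE eqxx.
- have /properP[_ [j jw _]] := cover_proper uw.
  by have /fintype.subsetP/(_ _ jw) := Kval_down wm; rewrite mi inE => /eqP <-.
- apply/negPn/negP => iw; apply: uu'.
  (* The valuation of [x] lies in [Kval w] and in [[set i]], which are disjoint here. *)
  have valE x : strict x = down w `|` down m -> Kval x = finset.set0.
    move=> xE; apply/eqP; rewrite -finset.subset0; apply/fintype.subsetP => j jx.
    have xw : strict x w by rewrite xE; left; apply: down_refl.
    have xm : strict x m by rewrite xE; right; apply: down_refl.
    have jm := fintype.subsetP (Kval_strict xm) _ jx.
    have := fintype.subsetP (Kval_strict xw) _ jx.
    by move: jm; rewrite mi !inE => /eqP ->; rewrite (negPf iw).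
  by apply: Kn_ext; rewrite ?ue ?ue' ?valE.
Qed.

(** * Density and bounded decreasing sets *)

Lemma Fhat_ext n (a b : Fhat n) : points a = points b -> a = b.
Proof.
by case: a b => [a da] [b db] /= E; subst b; rewrite (Prop_irrelevance da db).
Qed.

(** A difference at stage [d] makes the first differing index at most [d], hence the distance at
    least 2^-d. *)
Lemma Fhat_dist_lt (R : realType) n (a b : Fhat n) (d : nat) :
  (Fhat_dist R a b < 2 ^- d)%R ->
  points a `&` Kstage d = points b `&` Kstage d.
Proof.
rewrite /Fhat_dist => lt_ab; apply: contrapT => neq_ab.
have diff_d : differ_at a b d by apply/asboolP.
case: pselect lt_ab => [ex|[]]; last by exists d.
case: ex_minnP => k _ /(_ _ diff_d) kd; apply/negP; rewrite -leNgt.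
by rewrite lef_pV2 ?posrE ?exprn_gt0 // ler_weXn2l // ler1n.
Qed.

(* A point of level e.+1 has a point of level e below it, so a decreasing set
   with a point outside [K_n^d] has one at level d.+1. *)
Lemma decreasing_agree n (a h : set (Kn n)) (d : nat) :
  decreasing h -> a `<=` Kstage (n := n) d ->
  a `&` Kstage d.+1 = h `&` Kstage d.+1 -> a = h.
Proof.
move=> dh ad E; have a_h v : Kstage d.+1 v -> h v -> a v.
  by move=> vd hv; have [] : (a `&` Kstage d.+1) v by rewrite E.
apply/seteqP; split=> v.
  move=> av; have : (a `&` Kstage d.+1) v.
    by split=> //; apply: (Kstage_sub (leqnSn d)); apply: ad.
  by rewrite E => -[].
have [e] := Kn_level v; elim: e v => [|e IH] v ve hv.
  apply: a_h => //; apply: (Kstage_sub (leq0n _)).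
  by rewrite /Kstage /= stageE mem_cat ve orbT.
(* Past level [d.+1], freshness yields a point [u] of level [e] below [v]; by induction [a u], which
   puts [u] in K_n^d although [d < e]. *)
case: (leqP e d) => [ed|de].
  apply: a_h => //; apply: (Kstage_sub (d := e.+1)) => //.
  by rewrite /Kstage /= stageE mem_cat ve orbT.
have /allPn[t tv te] := level_fresh ve.
have {}te : t \notin prev_stage n e := te.
have tS := level_below ve tv; have [u ut] := prev_stage_Kn tS.
have au : a u.
  apply: IH; last by apply: dh hv _; rewrite /Kle /tree_le ut tv.
  by move: tS; rewrite prev_stageS stageE mem_cat (negPf te) ut.
case/negP: te; rewrite -ut; apply: (prev_stage_sub de).
by rewrite prev_stageS; apply: ad.
Qed.

(** The ball of radius 2^-(d+1) around [a] contains no other element, and density puts an element of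
    [H] in it. *)
Lemma dense_bounded (R : realType) n (H : set (Fhat n)) (a : Fhat n) :
  Fhat_dense R H -> (exists d, points a `<=` Kstage d) -> H a.
Proof.
move=> dH [d ad].
have [|h Hh /Fhat_dist_lt E] := dH a (2 ^- d.+1)%R.
  by rewrite invr_gt0 exprn_gt0.
by rewrite (Fhat_ext (decreasing_agree (points_decreasing (f := h)) ad E)).
Qed.

(** * First-order description of the generators *)

Definition HAle (M : HAstructure) (x y : M) : Prop := HAmeet x y = x.

(** Stronger than the usual covering relation. In a dense [H] it says that [u] is a principal set
    and [y] is [u] without its generator. *)
Definition HAcover (M : HAstructure) (u y : M) : Prop :=
  HAle y u /\ y <> u /\ forall c : M, HAle c u -> c <> u -> HAle c y.

(** This singles out the principal sets of minimal points with singleton valuation. The bottom is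
    named by [z] because [cover_formula] takes variables only. *)
Definition HAatom_single (M : HAstructure) (m : M) : Prop :=
  (exists z : M, z = HA0 M /\ HAcover m z) /\
  exists u : M, HAcover u m /\ forall u' : M, HAcover u' m -> u' = u.

(** The criterion of [Kval_count]: with [m] generated by a minimal point of valuation {P_i} and [w]
    by a point [t], it says that P_i is in the valuation of [t]. *)
Definition HAmember (M : HAstructure) (m w : M) : Prop :=
  (HAle m w /\ exists u : M, HAcover u w) \/
  (~ HAle m w /\ exists z : M, z = HAjoin w m /\
     exists u u' : M, u <> u' /\ HAcover u z /\ HAcover u' z).

(** A decreasing set is the union of its principal subsets, so testing [x] against the principal [w]
    determines it. *)
Definition HAgenerator (M : HAstructure) (x : M) : Prop :=
  exists m : M, HAatom_single m /\
    forall w : M, (exists y : M, HAcover w y) ->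
      (HAle w x -> HAmember m w) /\ (HAmember m w -> HAle w x).

(** * De Bruijn formulas and their interpretation *)

Lemma extend0 (A : Type) k (x : A) (e : 'I_k -> A) : extend x e ord0 = x.
Proof. by rewrite /extend unlift_none. Qed.

Lemma extendS (A : Type) k (x : A) (e : 'I_k -> A) (i : 'I_k) :
  extend x e (lift ord0 i) = e i.
Proof. by rewrite /extend liftK. Qed.

Local Notation sh i := (lift ord0 i).

Definition le_formula k (i j : 'I_k) : formula k :=
  Equal (Meet (Var i) (Var j)) (Var i).

Definition cover_formula k (u y : 'I_k) : formula k :=
  And (le_formula y u) (And (Not (Equal (Var y) (Var u)))
    (Forall (Defs.Implies (le_formula ord0 (sh u))
      (Defs.Implies (Not (Equal (Var ord0) (Var (sh u))))
        (le_formula ord0 (sh y)))))).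

Definition atom_single_formula k (m : 'I_k) : formula k :=
  And (Exists (And (Equal (Var ord0) (Zero _)) (cover_formula (sh m) ord0)))
    (Exists (And (cover_formula ord0 (sh m))
      (Forall (Defs.Implies (cover_formula ord0 (sh (sh m)))
                 (Equal (Var ord0) (Var (sh ord0))))))).

(** Under the innermost quantifiers, [sh (sh ord0)] is the join, and [sh ord0] and [ord0] are the
    two elements above it. *)
Definition member_formula k (m w : 'I_k) : formula k :=
  Or (And (le_formula m w) (Exists (cover_formula ord0 (sh w))))
    (And (Not (le_formula m w))
      (Exists (And (Equal (Var ord0) (Join (Var (sh w)) (Var (sh m))))
        (Exists (Exists (And (Not (Equal (Var (sh ord0)) (Var ord0)))
          (And (cover_formula (sh ord0) (sh (sh ord0)))
               (cover_formula ord0 (sh (sh ord0)))))))))).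

Definition generator_formula k (x : 'I_k) : formula k :=
  Exists (And (atom_single_formula ord0)
    (Forall (Defs.Implies (Exists (cover_formula (sh ord0) ord0))
      (And (Defs.Implies (le_formula ord0 (sh (sh x)))
                         (member_formula (sh ord0) ord0))
           (Defs.Implies (member_formula (sh ord0) ord0)
                         (le_formula ord0 (sh (sh x)))))))).

Lemma holds_equal (M : HAstructure) k (t1 t2 : term k) (e : 'I_k -> M) :
  holds (Equal t1 t2) e = (eval e t1 = eval e t2).
Proof. by []. Qed.

Lemma holds_not (M : HAstructure) k (f : formula k) (e : 'I_k -> M) :
  holds (Not f) e = ~ holds f e.
Proof. by []. Qed.

Lemma holds_and (M : HAstructure) k (f g : formula k) (e : 'I_k -> M) :
  holds (And f g) e = (holds f e /\ holds g e).
Proof. by []. Qed.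

Lemma holds_or (M : HAstructure) k (f g : formula k) (e : 'I_k -> M) :
  holds (Or f g) e = (holds f e \/ holds g e).
Proof. by []. Qed.

Lemma holds_implies (M : HAstructure) k (f g : formula k) (e : 'I_k -> M) :
  holds (Defs.Implies f g) e = (holds f e -> holds g e).
Proof. by []. Qed.

Lemma holds_forall (M : HAstructure) k (f : formula k.+1) (e : 'I_k -> M) :
  holds (Forall f) e = forall x : M, holds f (extend x e).
Proof. by []. Qed.

Lemma holds_exists (M : HAstructure) k (f : formula k.+1) (e : 'I_k -> M) :
  holds (Exists f) e = exists x : M, holds f (extend x e).
Proof. by []. Qed.

Lemma holds_le (M : HAstructure) k (i j : 'I_k) (e : 'I_k -> M) :
  holds (le_formula i j) e = HAle (e i) (e j).
Proof. by []. Qed.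

Lemma eval_var (M : HAstructure) k (i : 'I_k) (e : 'I_k -> M) :
  eval e (Var i) = e i.
Proof. by []. Qed.

Lemma eval_zero (M : HAstructure) k (e : 'I_k -> M) : eval e (Zero k) = HA0 M.
Proof. by []. Qed.

Lemma eval_join (M : HAstructure) k (t1 t2 : term k) (e : 'I_k -> M) :
  eval e (Join t1 t2) = HAjoin (eval e t1) (eval e t2).
Proof. by []. Qed.

Definition holdsE := (holds_le, holds_equal, holds_not, holds_and, holds_or,
  holds_implies, holds_forall, holds_exists,
  eval_var, eval_zero, eval_join, extend0, extendS).

Lemma holds_cover (M : HAstructure) k (u y : 'I_k) (e : 'I_k -> M) :
  holds (cover_formula u y) e = HAcover (e u) (e y).
Proof.
rewrite /cover_formula !holdsE; congr (_ /\ (_ /\ _)).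
by apply: eq_forall => c; rewrite !holdsE.
Qed.

(* Rewriting sees through the definition of [cover_formula], so its rule has to
   be tried before those for the connectives. *)
Definition holds_coverE := (holds_cover, holdsE).

Lemma holds_atom_single (M : HAstructure) k (m : 'I_k) (e : 'I_k -> M) :
  holds (atom_single_formula m) e = HAatom_single (e m).
Proof.
rewrite /atom_single_formula !holds_coverE.
congr (_ /\ _); apply: eq_exists => u; rewrite !holds_coverE //.
by congr (_ /\ _); apply: eq_forall => u'; rewrite !holds_coverE.
Qed.

Lemma holds_member (M : HAstructure) k (m w : 'I_k) (e : 'I_k -> M) :
  holds (member_formula m w) e = HAmember (e m) (e w).
Proof.
rewrite /member_formula !holds_coverE; congr ((_ /\ _) \/ (_ /\ _)).
  by apply: eq_exists => u; rewrite !holds_coverE.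
apply: eq_exists => z; rewrite !holds_coverE; congr (_ /\ _).
apply: eq_exists => u; rewrite !holds_coverE; apply: eq_exists => u'.
by rewrite !holds_coverE.
Qed.

Lemma holds_generator (M : HAstructure) k (x : 'I_k) (e : 'I_k -> M) :
  holds (generator_formula x) e = HAgenerator (e x).
Proof.
rewrite /generator_formula !holdsE; apply: eq_exists => m.
rewrite !(holds_atom_single, holdsE); congr (_ /\ _).
apply: eq_forall => w; rewrite !(holds_member, holdsE); congr (_ -> _).
by apply: eq_exists => y; rewrite !holds_coverE.
Qed.

Theorem theorem6p1 (R : realType) (n : nat) (hn : (1 <= n)%N)
    (H : set (FhatHA n)) (H_subalgebra : subalgebra H)
    (H_dense : Fhat_dense R H)
    (H_generators : forall i : 'I_n, H (generator i)) :
  definable_without_parameters (M := substructure H_subalgebra)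
    [set x | exists i : 'I_n, proj1_sig x = generator i].
Proof.
set M := substructure H_subalgebra.
pose pt (x : M) := points (proj1_sig x).
have pt_inj x y : pt x = pt y -> x = y.
  case: x y => [x Hx] [y Hy] /Fhat_ext E; simpl in E; subst y.
  by rewrite (Prop_irrelevance Hx Hy).
have ptD (x : M) : decreasing (pt x) := points_decreasing (f := proj1_sig x).
(* Density enters here; it puts the sets [down w] and [strict w] into [M]. *)
have pt_onto a : decreasing a -> (exists d, a `<=` Kstage (n := n) d) ->
    exists x, pt x = a.
  move=> da ad; have Ha := @dense_bounded R n H (MkFhat da) H_dense ad.
  by exists (exist H _ Ha).
have leE x y : HAle x y <-> pt x `<=` pt y.
  split=> [E v xv|xy].
    have : pt (HAmeet x y) v by rewrite E.
    by case.
  by apply: pt_inj; apply/seteqP; split=> [v []|v xv] //; split=> //; apply: xy.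
have pt_down w : exists x, pt x = down w.
  by apply: pt_onto; [apply: down_decreasing|apply: down_Kstage].
have coverE u y : HAcover u y <-> exists w, pt u = down w /\ pt y = strict w.
  split=> [[/leE yu [yNu umax]]|[w [uE yE]]].
    have [w uw yNw] : exists2 w, pt u w & ~ pt y w.
      apply: contrapT => noex; apply: yNu; apply: pt_inj; apply/seteqP.
      split=> // w uw; apply: contrapT => yNw; apply: noex.
      by exists w.
    (* Otherwise [down w] is strictly below [u], hence below [y], which omits [w]. *)
    have uE : pt u = down w.
      apply: contrapT => uNw; have [x xE] := pt_down w.
      suff /leE xy : HAle x y by apply: yNw; apply: xy; rewrite xE; apply: down_refl.
      apply: umax; first by apply/leE; rewrite xE; apply: down_min.
      by move=> E; apply: uNw; rewrite -xE E.
    exists w; split=> //.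
    have [d wd] := down_Kstage w.
    have [s sE] : exists s, pt s = strict w.
      apply: pt_onto; first exact: strict_decreasing.
      by exists d; apply: subset_trans wd; apply: strict_down.
    apply/seteqP; split=> v.
      move=> yv; have := yu _ yv; rewrite uE => /down_strict[//|vw].
      by case: yNw; rewrite -vw.
    (* As an element strictly below [u], [strict w] lies below the largest one, [y]. *)
    rewrite -sE => sv; suff /leE sy : HAle s y by apply: sy.
    apply: umax; first by apply/leE; rewrite sE uE; apply: strict_down.
    move=> E; case: (@strict_irr _ w); rewrite -sE E uE; apply: down_refl.
  split; first by apply/leE; rewrite uE yE; apply: strict_down.
  split=> [E|c /leE cu cNu].
    by case: (@strict_irr _ w); rewrite -yE E uE; apply: down_refl.
  apply/leE; rewrite yE => v cv; have := cu _ cv; rewrite uE.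
  case/down_strict => // vw; case: cNu; apply: pt_inj; apply/seteqP; split=> //.
  by rewrite uE; apply: down_min => //; rewrite -vw.
(* Elements just above [y] thus correspond to the points whose strict predecessors form [Y], so
   counting the former counts the latter. *)
have cover_at y (Y : set (Kn n)) u : pt y = Y -> HAcover u y <->
    exists2 w, pt u = down w & strict w = Y.
  move=> yY; split=> [/coverE[w [uw yw]]|[w uw wY]].
    by exists w; rewrite // -yY.
  by apply/coverE; exists w; rewrite yY.
have atomE m : HAatom_single m <-> exists w i,
    [/\ pt m = down w, strict w = set0 & Kval w = [set i]%SET].
  split=> [[[z [-> /coverE[w [mw w0]]]] [u [um uniq_u]]]|[w [i [mw w0 wi]]]].
    exists w; suff [i wi] : exists i, Kval w = [set i]%SET by exists i.
    apply/Kval_singleton.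
    have /(cover_at _ _ _ mw)[t ut tw] := um; exists t; split=> // t' t'w.
    have [x xt'] := pt_down t'; apply: down_inj; rewrite -ut -xt'.
    by congr pt; apply: uniq_u; apply/(cover_at _ _ _ mw); exists t'.
  split; first by exists (HA0 M); split=> //; apply/coverE; exists w.
  have [t [tw uniq_t]] : exists u, strict u = down w /\
      forall u', strict u' = down w -> u' = u by apply/Kval_singleton; exists i.
  have [u ut] := pt_down t; exists u.
  split=> [|u' /(cover_at _ _ _ mw)[t' u't' t'w]].
    by apply/(cover_at _ _ _ mw); exists t.
  by apply: pt_inj; rewrite u't' ut (uniq_t _ t'w).
have le_down x y v w : pt x = down v -> pt y = down w -> HAle x y <-> down w v.
  move=> xE yE; rewrite leE xE yE; split=> [|wv]; first by apply; apply: down_refl.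
  exact: (down_min (@down_decreasing _ w)).
have memberE m w v t i : pt m = down v -> pt w = down t -> strict v = set0 ->
    Kval v = [set i]%SET -> HAmember m w <-> i \in Kval t.
  move=> mE wE v0 vi; rewrite (Kval_count t v0 vi) /HAmember (le_down _ _ _ _ mE wE).
  have joinE : pt (HAjoin w m) = down t `|` down v by rewrite -mE -wE.
  split=> -[[vt]|[vt]].
  - by case=> u /(cover_at _ _ _ wE)[x _ xt]; left; split=> //; exists x.
  - case=> _ [-> [u [u' [uu' [/(cover_at _ _ _ joinE)[x ux xt]]]]]].
    case/(cover_at _ _ _ joinE)=> [x' ux' xt'].
    right; split=> //; exists x, x'; split=> // E; apply: uu'; apply: pt_inj.
    by rewrite ux ux' E.
  - case=> x xt; left; split=> //; have [u ux] := pt_down x; exists u.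
    by apply/(cover_at _ _ _ wE); exists x.
  - case=> x [x' [xx' xt xt']]; right; split=> //; exists (HAjoin w m); split=> //.
    have [u ux] := pt_down x; have [u' ux'] := pt_down x'; exists u, u'; split.
      by move=> E; apply: xx'; apply: down_inj; rewrite -ux -ux' E.
    by split; apply/(cover_at _ _ _ joinE); [exists x|exists x'].
(* Hence the quantifier over [w] in [HAgenerator] reaches every point of K_n. *)
have cover_down t : exists w y, pt w = down t /\ HAcover w y.
  have [d td] := down_Kstage t; have [w wE] := pt_down t.
  have [y yE] : exists y, pt y = strict t.
    apply: pt_onto; first exact: strict_decreasing.
    by exists d; apply: subset_trans td; apply: strict_down.
  by exists w, y; split=> //; apply/coverE; exists t.
have le_point w t x : pt w = down t -> HAle w x <-> pt x t.
  move=> wE; rewrite leE wE; split=> [|xt]; first by apply; apply: down_refl.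
  exact: down_min.
exists (generator_formula ord0) => x; rewrite holds_generator.
split=> [[m [/atomE[v [i [mE v0 vi]]] mx]]|[i xi]].
  exists i; apply: Fhat_ext; apply/seteqP; split=> t.
    have [w [y [wE wy]]] := cover_down t; have [wx _] := mx w (ex_intro _ y wy).
    by move=> xt; apply/(memberE _ _ _ _ _ mE wE v0 vi)/wx/(le_point _ _ _ wE).
  have [w [y [wE wy]]] := cover_down t; have [_ xw] := mx w (ex_intro _ y wy).
  by move=> it; apply/(le_point _ _ _ wE)/xw/(memberE _ _ _ _ _ mE wE v0 vi).
(* The minimal point with valuation {P_i}: here [Y] is empty, and no principal set is empty, so no
   valuation is excluded. *)
have [v [v0 vi]] : exists v : Kn n, strict v = set0 /\ Kval v = [set i]%SET.
  apply: (@Kn_exists n 0) => // v E.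
  by have := down_refl v; rewrite -E.
have [m mE] := pt_down v; exists m; split; first by apply/atomE; exists v, i.
move=> w [y /coverE[t [wE _]]].
have xE : pt x t <-> i \in Kval t by rewrite /pt xi.
by split=> [/(le_point _ _ _ wE)/xE/(memberE _ _ _ _ _ mE wE v0 vi)
           |/(memberE _ _ _ _ _ mE wE v0 vi)/xE/(le_point _ _ _ wE)].
Qed.
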